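(* Let $G_n$ be $\mathrm{Sp}_{2n}(F)$ or an even orthogonal group $\mathrm O(W_n)$. (1) If $T$ is a raising operator applicable on $\psi\in\Psi(G_n)$, then $T(\psi)\gneq_D\psi$. In particular, if $\psi\ge_O\psi'$, then $\psi\ge_D\psi'$. (2) Let $\pi$ be an irreducible representation of $G_n$ of Arthur type. Then $\psi^{max}(\pi)$ and $\psi^{min}(\pi)$ are the unique elements of $\Psi(\pi)$ satisfying $$\psi^{max}(\pi)\ge_D\psi\ge_D\psi^{min}(\pi)$$ for all $\psi\in\Psi(\pi)$.
   Context: $F$ is a non-Archimedean local field of characteristic $0$; $W_n$ is a nondegenerate quadratic space over $F$ of dimension $2n$ and discriminant $d$ ($\mathrm O(W_n)$ may or may not be quasi-split); $\chi_W$ is the character attached to $F(\sqrt d)/F$. $\rho$ denotes an irreducible unitary supercuspidal representation of some $\mathrm{GL}_d(F)$, identified with a bounded irreducible $d$-dimensional representation of the Weil group $W_F$; $S_a$ is the $a$-dimensional irreducible representation of $\mathrm{SL}_2(\mathbb C)$. $\Psi(G_n)$ is the set of isomorphism classes of $N$-dimensional orthogonal representations $\psi=\bigoplus_i\rho_i\otimes S_{a_i}\otimes S_{b_i}$ of $W_F\times\mathrm{SL}_2(\mathbb C)\times\mathrm{SL}_2(\mathbb C)$, with $N=2n+1$ and trivial determinant if $G_n=\mathrm{Sp}_{2n}(F)$, and $N=2n$ and determinant $\chi_W$ if $G_n=\mathrm O(W_n)$. $\Pi_\psi$ is the local Arthur packet (Arthur, Mœglin, Mœglin–Renard); $\Psi(\pi)=\{\psi\in\Psi(G_n)\mid\pi\in\Pi_\psi\}$;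 $\pi$ is of Arthur type if $\Psi(\pi)\ne\emptyset$. A summand is of good parity if it is self-dual and orthogonal. Order $\ge_O$: write $\langle A,B\rangle_\rho=\rho\otimes S_{A+B+1}\otimes S_{A-B+1}$ ($\langle A,A+1\rangle_\rho=0$). A raising operator $T$ replaces $\psi$ by a different parameter $T(\psi)$ obtained by one of the following moves on summands of good parity (''applicable'' means that the move can be performed): (i) replace $\langle A_j,B_i\rangle_\rho+\langle A_i,B_j\rangle_\rho$ by $\langle A_i,B_i\rangle_\rho+\langle A_j,B_j\rangle_\rho$, where $A_j>A_i$, $B_j>B_i$, $A_i\ge B_j-1$; (ii) replace $\langle A_i,B_i\rangle_\rho+\langle A_j,B_j\rangle_\rho$ by $\langle A_j,B_i\rangle_\rho+\langle A_i,B_j\rangle_\rho$, where $A_j>A_i$, $-B_j>-B_i$, $A_i\ge-B_j-1$ (second summand omitted if $A_i=-B_j-1$); (iii) replace $\langle A_k,-\frac12\rangle_\rho$ by $\langle A_k,\frac12\rangle_\rho$. $\psi_1\ge_O\psi_2$ means $\psi_1=\psi_2$ or $\psi_1=T_r\circ\cdots\circ T_1(\psi_2)$ for raising operators $T_i$. For $\pi$ of Arthur type, $\Psi(\pi)$ has a unique maximal element $\psi^{max}(\pi)$ and a unique minimal element $\psi^{min}(\pi)$ for $\ge_O$. Preorder $\ge_D$: for $\psi=\bigoplus_{i=1}^r\rho_i\otimes S_{a_i}\otimes S_{b_i}$ with $d_i=\dim\rho_i$ (the first $\mathrm{SL}_2$ being the Deligne one), let $\underline p^D(\psi)=[a_1^{d_1b_1},\dots,a_r^{d_rb_r}]$,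 a partition of $N$. $\psi_1\ge_D\psi_2$ means $\underline p^D(\psi_1)\ge\underline p^D(\psi_2)$ in the dominance order; $\gneq_D$ denotes the strict relation ($\underline p^D(\psi_1)>\underline p^D(\psi_2)$). *)

(* Defs.v *)
From HB Require Import structures.
From mathcomp Require Import all_boot all_order all_algebra archimedean.
From mathcomp Require Import finmap multiset boolp reals complex mxtens.

Set Implicit Arguments.
Unset Strict Implicit.
Unset Printing Implicit Defensive.

Import Order.TTheory GRing.Theory Num.Theory.

Local Open Scope ring_scope.
Local Open Scope mset_scope.

(* The value of [v] at 0 is irrelevant; [val_ge v x m] is "v(x) >= m" with the
   usual convention v(0) = +oo. *)
Definition val_ge (F : fieldType) (v : F -> int) (x : F) (m : int) : bool :=
  (x == 0) || (m <= v x).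

Record localField := LocalField {
  lf_sort :> fieldType;
  lf_val : lf_sort -> int;
  lf_q : nat;
  lf_char0 : [pchar lf_sort] =i pred0;
  lf_valM : forall x y : lf_sort, x != 0 -> y != 0 ->
    lf_val (x * y) = lf_val x + lf_val y;
  lf_valD : forall (x y : lf_sort) (m : int),
    val_ge lf_val x m -> val_ge lf_val y m -> val_ge lf_val (x + y) m;
  lf_val_normalized : exists2 x : lf_sort, x != 0 & lf_val x = 1;
  lf_complete : forall u : nat -> lf_sort,
    (forall m : int, exists K : nat, forall i j : nat,
        (K <= i)%N -> (K <= j)%N -> val_ge lf_val (u i - u j) m) ->
    exists l : lf_sort, forall m : int, exists K : nat, forall i : nat,
        (K <= i)%N -> val_ge lf_val (u i - l) m;
  (* the residue field is finite with q elements: s is a system of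
     representatives of O / m *)
  lf_residue : exists s : seq lf_sort,
    [/\ size s = lf_q, uniq s, (forall x, x \in s -> val_ge lf_val x 0) &
        forall x, val_ge lf_val x 0 ->
          exists! y, y \in s /\ val_ge lf_val (x - y) 1]
}.

Section Weil.
Context (F : localField) (Fbar : closedFieldType) (iota : {rmorphism F -> Fbar}).

Definition algebraic_closure : Prop :=
  forall x : Fbar, exists2 p : {poly F}, p != 0 & root (map_poly iota p) x.

Definition integral (x : Fbar) : Prop :=
  exists p : {poly F},
    [/\ p \is monic, (forall i, val_ge (@lf_val F) p`_i 0) &
        root (map_poly iota p) x].

Definition in_max_ideal (x : Fbar) : Prop :=
  integral x /\ (x = 0 \/ ~ integral x^-1).

Definition galois_elt (w : Fbar -> Fbar) : Prop :=
  [/\ {morph w : x y / x + y}, {morph w : x y / x * y}, bijective w &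
      forall x : F, w (iota x) = iota x].

(* w acts on the residue field of Fbar as x |-> x ^ (q ^ k) for some k in Z *)
Definition weil_elt (w : Fbar -> Fbar) : Prop :=
  galois_elt w /\
  exists k : nat,
    (forall x, integral x -> in_max_ideal (w x - x ^+ (lf_q F ^ k))) \/
    (forall x, integral x -> in_max_ideal ((w x) ^+ (lf_q F ^ k) - x)).

Definition inertia_elt (w : Fbar -> Fbar) : Prop :=
  galois_elt w /\ (forall x, integral x -> in_max_ideal (w x - x)).

End Weil.

Section WeilRep.
Context (R : realType) (F : localField) (Fbar : closedFieldType)
        (iota : {rmorphism F -> Fbar}).
Local Notation C := R[i].
Local Notation W := (weil_elt iota).

(* Continuity is expressed as triviality on an open subgroup of inertia, i.e. on
   the elements of inertia fixing a finitely generated extension F(xs). *)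
Record weilIrr := WeilIrr {
  wdim : nat;
  wact :> (Fbar -> Fbar) -> 'M[C]_wdim;
  wact1 : wact id = 1%:M;
  wactM : forall w1 w2, W w1 -> W w2 -> wact (w1 \o w2) = wact w1 *m wact w2;
  wact_cont : exists xs : seq Fbar, forall w, inertia_elt iota w ->
    (forall x, x \in xs -> w x = x) -> wact w = 1%:M;
  wact_bounded : exists M : C, forall w, W w -> forall i j, `|wact w i j| <= M;
  wdim_gt0 : (0 < wdim)%N;
  wact_irr : forall U : 'M[C]_wdim,
    (forall w, W w -> (U *m wact w <= U)%MS) -> U = 0 \/ row_full U
}.

Definition weil_iso (r1 r2 : weilIrr) : Prop :=
  exists (P : 'M[C]_(wdim r1, wdim r2)) (Q : 'M[C]_(wdim r2, wdim r1)),
    [/\ P *m Q = 1%:M, Q *m P = 1%:M &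
        forall w, W w -> r1 w *m P = P *m r2 w].

HB.instance Definition _ := gen_eqMixin weilIrr.
HB.instance Definition _ := gen_choiceMixin weilIrr.

Definition weil_isob (r1 r2 : weilIrr) : bool := `[< weil_iso r1 r2 >].

Lemma weil_isob_refl : reflexive weil_isob.
Proof.
move=> r; apply/asboolP; exists 1%:M, 1%:M.
by split=> [||w _]; rewrite ?mul1mx ?mulmx1.
Qed.

Lemma weil_isob_sym : symmetric weil_isob.
Proof.
suff H r1 r2 : weil_isob r1 r2 -> weil_isob r2 r1 by move=> r1 r2; apply/idP/idP; apply: H.
move=> /asboolP [P [Q [PQ QP PI]]]; apply/asboolP; exists Q, P; split=> // w Ww.
by rewrite -[RHS]mulmx1 -PQ mulmxA -(mulmxA Q) PI // mulmxA QP mul1mx.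
Qed.

Lemma weil_isob_trans : transitive weil_isob.
Proof.
move=> r2 r1 r3 /asboolP [P [Q [PQ QP PI]]] /asboolP [P' [Q' [PQ' QP' PI']]].
apply/asboolP; exists (P *m P'), (Q' *m Q); split=> [||w Ww].
- by rewrite mulmxA -(mulmxA P) PQ' mulmx1.
- by rewrite mulmxA -(mulmxA Q') QP mulmx1.
by rewrite mulmxA PI // -mulmxA PI' // mulmxA.
Qed.

Definition weil_equiv :=
  EquivRel weil_isob weil_isob_refl weil_isob_sym weil_isob_trans.

Definition weilClass : Type := {eq_quot weil_equiv}%qT.
HB.instance Definition _ := Choice.on weilClass.

Definition class_rep (rho : weilClass) : weilIrr := repr (rho : {eq_quot weil_equiv}%qT).
Definition class_dim (rho : weilClass) : nat := wdim (class_rep rho).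

Record rep := Rep {
  rdim : nat;
  ract :> (Fbar -> Fbar) -> 'M[C]_2 -> 'M[C]_2 -> 'M[C]_rdim
}.

Definition rep0 : rep := @Rep 0 (fun _ _ _ => 0).
Definition rep_sum (r1 r2 : rep) : rep :=
  Rep (fun w x y => block_mx (r1 w x y) 0 0 (r2 w x y)).

Definition rep_orthogonal (r : rep) : Prop :=
  exists B : 'M[C]_(rdim r),
    [/\ B^T = B, B \in unitmx &
        forall w x y, W w -> \det x = 1 -> \det y = 1 ->
          (r w x y)^T *m B *m r w x y = B].

(* S_a: action of g on binary forms of degree a-1 (dehomogenized at Y = 1);
   row i gives the image of X^i Y^(a-1-i) under X |-> g00 X + g01 Y,
   Y |-> g10 X + g11 Y *)
Definition Smx (a : nat) (g : 'M[C]_2) : 'M[C]_a :=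
  \matrix_(i, j)
    (((g 0 0)%:P * 'X + (g 0 1)%:P) ^+ i *
     ((g 1 0)%:P * 'X + (g 1 1)%:P) ^+ (a.-1 - i))`_j.

(* (rho, a, b) stands for rho (x) S_a (x) S_b *)
Definition summand : Type := (weilClass * nat * nat)%type.
HB.instance Definition _ := Choice.on summand.

Definition summand_rep (s : summand) : rep :=
  let: (rho, a, b) := s in
  Rep (fun w x y => (class_rep rho w *t Smx a x) *t Smx b y).

Definition good_parity (s : summand) : Prop := rep_orthogonal (summand_rep s).

(* An isomorphism class of representations (+)_i rho_i (x) S_{a_i} (x) S_{b_i} is
   the multiset of its irreducible constituents. *)
Definition param : Type := {mset summand}.

Definition param_rep (psi : param) : rep :=
  foldr rep_sum rep0 (map summand_rep (enum_mset psi)).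

End WeilRep.

Arguments weilClass R {F Fbar} iota.
Arguments summand R {F Fbar} iota.
Arguments param R {F Fbar} iota.

Record quadSpace (F : fieldType) (n : nat) := QuadSpace {
  gram : 'M[F]_(n + n);
  gram_sym : gram^T = gram;
  gram_nondeg : gram \in unitmx
}.

(* normalized so that the split space (n hyperbolic planes) has discriminant 1 *)
Definition disc (F : fieldType) (n : nat) (V : quadSpace F n) : F :=
  (-1) ^+ n * \det (gram V).

Inductive classicalGroup (F : fieldType) :=
| Sp of nat
| Orth (n : nat) of quadSpace F n.
Arguments Sp {F} n.

Definition grank (F : fieldType) (G : classicalGroup F) : nat :=
  match G with Sp n => n | Orth n _ => n end.

Definition gform (F : fieldType) (G : classicalGroup F) :
    'M[F]_(grank G + grank G) :=
  match G with
  | Sp n => block_mx 0 1%:M (- 1%:M) 0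
  | Orth n V => gram V
  end.

Definition gmem (F : fieldType) (G : classicalGroup F)
    (g : 'M[F]_(grank G + grank G)) : bool :=
  g^T *m gform G *m g == gform G.

Record groupIrr (R : realType) (F : localField) (G : classicalGroup F) := GroupIrr {
  gspace : lmodType R[i];
  gact : 'M[F]_(grank G + grank G) -> gspace -> gspace;
  gact_linear : forall g, gmem g -> linear (gact g);
  gact1 : forall v, gact 1%:M v = v;
  gactM : forall g h v, gmem g -> gmem h -> gact (g *m h) v = gact g (gact h v);
  gact_smooth : forall v, exists m : int, forall g, gmem g ->
    (forall i j, val_ge (@lf_val F) ((g - 1%:M) i j) m) -> gact g v = v;
  gspace_neq0 : exists v : gspace, v != 0;
  gact_irr : forall U : gspace -> Prop,
    U 0 -> (forall (c : R[i]) u v, U u -> U v -> U (c *: u + v)) ->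
    (forall g v, gmem g -> U v -> U (gact g v)) ->
    (forall v, U v -> v = 0) \/ (forall v, U v)
}.

Section ArthurParam.
Context (R : realType) (F : localField) (Fbar : closedFieldType)
        (iota : {rmorphism F -> Fbar}).
Local Notation C := R[i].
Local Notation param := (param R iota).
Local Notation weilClass := (weilClass R iota).

(* the character of F(sqrt d)/F, viewed on the Weil group through its action on
   the square roots of d in Fbar; trivial when d is a square *)
Definition quad_char (d : F) (w : Fbar -> Fbar) : C :=
  if `[< forall s : Fbar, s ^+ 2 = iota d -> w s = s >] then 1 else -1.

Definition param_dim (G : classicalGroup F) : nat :=
  match G with Sp n => (n + n).+1 | Orth n _ => n + n end.

Definition param_det (G : classicalGroup F) (w : Fbar -> Fbar) : C :=
  match G with Sp _ => 1 | Orth _ V => quad_char (disc V) w end.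

Definition Psi (G : classicalGroup F) (psi : param) : Prop :=
  [/\ (forall s, s \in psi -> (0 < s.1.2)%N && (0 < s.2)%N),
      rdim (param_rep psi) = param_dim G,
      rep_orthogonal iota (param_rep psi) &
      forall w x y, weil_elt iota w -> \det x = 1 -> \det y = 1 ->
        \det (param_rep psi w x y) = param_det G w].

(* A and B are half-integers with A+B+1 >= 1 and A-B+1 >= 1 integers *)
Definition is_seg (A B : rat) : bool :=
  (A + B \is a Num.nat) && (A - B \is a Num.nat).

(* rho (x) S_{A+B+1} (x) S_{A-B+1}, which is 0 when A+B+1 or A-B+1 is 0; this covers
   <A, A+1>_rho = 0 and the omitted summand <A, -A-1>_rho of the second move *)
Definition seg (rho : weilClass) (A B : rat) : param :=
  let a := Num.truncn (A + B + 1) in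
  let b := Num.truncn (A - B + 1) in
  if (0 < a)%N && (0 < b)%N then [mset (rho, a, b)] else mset0.

Inductive raising_op :=
| Raise1 (rho : weilClass) (Ai Bi Aj Bj : rat)
| Raise2 (rho : weilClass) (Ai Bi Aj Bj : rat)
| Raise3 (rho : weilClass) (Ak : rat).

Definition op_source (T : raising_op) : param :=
  match T with
  | Raise1 rho Ai Bi Aj Bj => seg rho Aj Bi `+` seg rho Ai Bj
  | Raise2 rho Ai Bi Aj Bj => seg rho Ai Bi `+` seg rho Aj Bj
  | Raise3 rho Ak => seg rho Ak (- (1 / 2))
  end.

Definition op_target (T : raising_op) : param :=
  match T with
  | Raise1 rho Ai Bi Aj Bj => seg rho Ai Bi `+` seg rho Aj Bj
  | Raise2 rho Ai Bi Aj Bj => seg rho Aj Bi `+` seg rho Ai Bj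
  | Raise3 rho Ak => seg rho Ak (1 / 2)
  end.

Definition op_cond (T : raising_op) : Prop :=
  match T with
  | Raise1 _ Ai Bi Aj Bj =>
      [/\ is_seg Aj Bi, is_seg Ai Bj \/ Ai = Bj - 1, is_seg Ai Bi & is_seg Aj Bj]
      /\ [/\ Aj > Ai, Bj > Bi & Ai >= Bj - 1]
  | Raise2 _ Ai Bi Aj Bj =>
      [/\ is_seg Ai Bi, is_seg Aj Bj, is_seg Aj Bi & is_seg Ai Bj \/ Ai = - Bj - 1]
      /\ [/\ Aj > Ai, - Bj > - Bi & Ai >= - Bj - 1]
  | Raise3 _ Ak => is_seg Ak (- (1 / 2)) /\ is_seg Ak (1 / 2)
  end.

Definition apply_op (T : raising_op) (psi : param) : param :=
  (psi `\` op_source T) `+` op_target T.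

Definition applicable (T : raising_op) (psi : param) : Prop :=
  [/\ op_cond T,
      (op_source T `<=` psi),
      (forall s, s \in op_source T -> good_parity s) &
      apply_op T psi != psi].

(* [geO psi1 psi2] is psi1 >=_O psi2, so the raised parameter comes first *)
Inductive geO : param -> param -> Prop :=
| geO_refl psi : geO psi psi
| geO_raise psi1 psi2 T :
    geO psi1 psi2 -> applicable T psi1 -> geO (apply_op T psi1) psi2.

Definition dominates (l m : seq nat) : Prop :=
  sumn l = sumn m /\ forall k : nat, (sumn (take k m) <= sumn (take k l))%N.

Definition pD (psi : param) : seq nat :=
  sort geq (flatten [seq (let: (rho, a, b) := s in nseq (class_dim rho * b) a)
                    | s <- enum_mset psi]).

Definition geD (psi1 psi2 : param) : Prop := dominates (pD psi1) (pD psi2).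
Definition gtD (psi1 psi2 : param) : Prop := geD psi1 psi2 /\ pD psi1 <> pD psi2.

(* The local Arthur packets enter as a parameter: [packet psi pi] stands for
   "pi belongs to Pi_psi". *)
Definition Psi_of (G : classicalGroup F)
    (packet : param -> groupIrr R G -> Prop) (pi : groupIrr R G) (psi : param) : Prop :=
  Psi G psi /\ packet psi pi.

Definition arthur_type (G : classicalGroup F)
    (packet : param -> groupIrr R G -> Prop) (pi : groupIrr R G) : Prop :=
  exists psi, Psi_of packet pi psi.

Definition maximal_O (S : param -> Prop) (psi : param) : Prop :=
  S psi /\ forall phi, S phi -> geO phi psi -> phi = psi.
Definition minimal_O (S : param -> Prop) (psi : param) : Prop :=
  S psi /\ forall phi, S phi -> geO psi phi -> phi = psi.

Definition is_psi_max (G : classicalGroup F)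
    (packet : param -> groupIrr R G -> Prop) (pi : groupIrr R G) : param -> Prop :=
  unique (maximal_O (Psi_of packet pi)).
Definition is_psi_min (G : classicalGroup F)
    (packet : param -> groupIrr R G -> Prop) (pi : groupIrr R G) : param -> Prop :=
  unique (minimal_O (Psi_of packet pi)).

End ArthurParam.

Arguments raising_op R {F Fbar} iota.

(* Main.v *)
(* Dominance between partitions of the same integer amounts to an inequality
   between the sums of the convex functions (x - t)^+ over the parts.  Every
   raising operator replaces, [d = dim rho] times, the parts
   (a+p)^(b+p+q), (a+q)^b by a^(b+q), (a+p+q)^(b+p) with p, q > 0, so convexity
   gives the dominance, and the sum of the squares of the parts strictly
   increases.  As this sum is bounded, climbing (or descending) for >=_O inside
   Psi(pi) stops at a maximal (or minimal) element, so psi^max and psi^min are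
   extremal for >=_O, hence for >=_D; uniqueness follows since >=_D in both
   directions between >=_O-comparable parameters forces equality. *)
Require Import Defs.
From mathcomp Require Import all_boot all_order all_algebra archimedean.
From mathcomp Require Import finmap multiset boolp reals complex.
From mathcomp Require Import zify lra.

Set Implicit Arguments.
Unset Strict Implicit.
Unset Printing Implicit Defensive.

Import Order.TTheory GRing.Theory Num.Theory.

Local Open Scope mset_scope.

(** * Dominance order and truncated differences *)

Section Dominance.
Implicit Types (l m : seq nat) (k t : nat).

Lemma leq_sumn_take l k t :
  sumn (take k l) <= k * t + sumn [seq x - t | x <- l].
Proof.
elim: l k => [|x l IHl] [|k] //=.
by have := IHl k; rewrite mulSn; lia.
Qed.

Lemma sumn_take_sorted l k : sorted geq l ->
  sumn (take k l) = k * nth 0 l k + sumn [seq x - nth 0 l k | x <- l].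
Proof.
elim: l k => [|x l IHl] [|k] //= sl.
- by rewrite muln0.
- have /allP le_x : all (geq x) l.
    by apply: order_path_min sl => ? ? ? /=; lia.
  rewrite subnn; apply/esym.
  elim: l le_x {IHl sl} => //= y l IHl le_x.
  have /eqP -> : y <= x by apply: le_x; rewrite mem_head.
  by apply: IHl => z zl; apply: le_x; rewrite inE zl orbT.
have /allP le_x : all (geq x) l.
  by apply: order_path_min sl => ? ? ? /=; lia.
have le_kx : nth 0 l k <= x.
  (* Past the end of the list the threshold is the default 0. *)
  have [lt_kl|le_lk] := ltnP k (size l); last by rewrite nth_default.
  by apply: le_x; rewrite mem_nth.
by rewrite IHl ?(path_sorted sl) // mulSn; lia.
Qed.

(* The sum of the [k] largest entries of [l] is the minimum over [t] of
   [k * t] plus the sum of the [(x - t)^+], attained at [t = nth 0 l k]. *)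
Lemma dominates_convex l m : sorted geq l -> sumn l = sumn m ->
    (forall t, sumn [seq x - t | x <- m] <= sumn [seq x - t | x <- l]) ->
  dominates l m.
Proof.
move=> sl eq_lm le_ml; split=> // k; rewrite (sumn_take_sorted k sl).
exact: leq_trans (leq_sumn_take m k (nth 0 l k)) (leq_add _ (le_ml _)).
Qed.

Lemma dominates_refl l : dominates l l.
Proof. by []. Qed.

Lemma dominates_trans l m n : dominates l m -> dominates m n -> dominates l n.
Proof.
move=> [lm tlm] [mn tmn]; split; first by rewrite lm.
by move=> k; apply: leq_trans (tmn k) (tlm k).
Qed.

(** Prefix sums determine the entries up to trailing zeros, which positivity excludes. *)
Lemma dominates_anti l m : all (ltn 0) l -> all (ltn 0) m ->
  dominates l m -> dominates m l -> l = m.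
Proof.
move=> + + [_ lm] [_ ml].
have {lm ml} : forall k, sumn (take k l) = sumn (take k m).
  by move=> k; apply/eqP; rewrite eqn_leq lm ml.
elim: l m => [|x l IHl] [|y m] //= eq_lm.
- by move=> _ /andP[y_gt0 _]; have := eq_lm 1; rewrite /= take0 /=; lia.
- by move=> /andP[x_gt0 _]; have := eq_lm 1; rewrite /= take0 /=; lia.
move=> /andP[_ l_gt0] /andP[_ m_gt0].
have xy : x = y by have := eq_lm 1; rewrite /= !take0 /=; lia.
rewrite xy; congr cons; apply: IHl => // k.
by have := eq_lm k.+1; rewrite /= xy => /addnI.
Qed.

End Dominance.

Lemma leq_sumn_sqr (l : seq nat) : sumn [seq x ^ 2 | x <- l] <= sumn l ^ 2.
Proof. by elim: l => //= x l IHl; rewrite sqrnD; lia. Qed.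

Lemma enum_msetD (K : choiceType) (A B : {mset K}) :
  perm_eq (enum_mset (A `+` B)) (enum_mset A ++ enum_mset B).
Proof.
by apply/allP => x _ /=; rewrite count_cat !count_mem_mset msetE2.
Qed.

(** * Effect of raising operators on partitions *)

Section Params.
Context (R : realType) (F : localField) (Fbar : closedFieldType)
        (iota : {rmorphism F -> Fbar}).
Local Notation param := (param R iota).
Local Notation raising_op := (raising_op R iota).
Implicit Types (psi phi : param) (f : nat -> nat) (T : raising_op).

(** Being additive in the parameter, it avoids the sorting in [pD]. The functions used are [id] for
    the total, [expn^~ 2] for strictness and [subn^~ t] for dominance. *)
Definition weight f psi : nat :=
  \sum_(s <- enum_mset psi) class_dim s.1.1 * s.2 * f s.1.2.

Lemma weight_pD f psi : sumn [seq f x | x <- pD psi] = weight f psi.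
Proof.
rewrite /pD (perm_sumn (perm_map f (permEl (perm_sort _ _)))) /weight.
elim: (enum_mset psi) => [|[[rho a] b] s IHs] /=; first by rewrite big_nil.
by rewrite big_cons -IHs map_cat sumn_cat map_nseq sumn_nseq mulnC.
Qed.

Lemma sumn_pD psi : sumn (pD psi) = weight id psi.
Proof. by rewrite -weight_pD map_id. Qed.

Lemma weightD f psi phi : weight f (psi `+` phi) = weight f psi + weight f phi.
Proof. by rewrite /weight (perm_big _ (enum_msetD _ _)) big_cat. Qed.

Lemma weight_seg f rho A B a b : f 0 = 0 ->
    (A + B + 1 = a%:R)%R -> (A - B + 1 = b%:R)%R ->
  weight f (seg (iota := iota) rho A B) = class_dim rho * b * f a.
Proof.
move=> f0 aE bE; rewrite /seg /weight aE bE !natrK.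
case: ifP => [_|/negbT]; first by rewrite enum_msetn big_seq1.
rewrite enum_mset0 big_nil negb_and -!eqn0Ngt.
by case/orP => /eqP ->; rewrite ?f0 ?muln0.
Qed.

Lemma class_dim_gt0 (rho : weilClass R iota) : 0 < class_dim rho.
Proof. exact: wdim_gt0. Qed.

(* With [a] the smaller of the first [SL_2] dimensions of the new summands, all
   three moves spread [(a+p)^(b+p+q), (a+q)^b] out to [a^(b+q), (a+p+q)^(b+p)].
   A summand with [S_0] is omitted from the multiset, whence [f 0 = 0]. *)
Lemma op_weight T : op_cond T ->
  exists d a b p q, [/\ 0 < d, 0 < p, 0 < q & forall f, f 0 = 0 ->
    weight f (op_source T) = d * ((b + p + q) * f (a + p) + b * f (a + q)) /\
    weight f (op_target T) = d * ((b + q) * f a + (b + p) * f (a + p + q))].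
Proof.
have subr_nat (x y : rat) : x \is a Num.nat -> y \is a Num.nat ->
    (x <= y)%R -> exists n, (y - x = n%:R)%R.
  by move=> xN yN xy; apply/natrP; rewrite natrEint subr_ge0 xy rpredB ?intr_nat.
case: T => [rho Ai Bi Aj Bj|rho Ai Bi Aj Bj|rho Ak] /=; rewrite /is_seg.
- move=> [[/andP[jiD _] _ /andP[iiD iiB] /andP[jjD _]] [ltA ltB leAB]].
  have [p pE] := subr_nat _ _ iiD jiD ltac:(lra).
  have [q qE] := subr_nat _ _ jiD jjD ltac:(lra).
  have /natrP[a aE] : (Ai + Bi + 1)%R \is a Num.nat by rewrite rpredD ?rpred1.
  have iiB1 : (Ai - Bi + 1)%R \is a Num.nat by rewrite rpredD ?rpred1.
  (* Here [b] is [Ai - Bj + 1], zero exactly when the second source summand is omitted. *)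
  have [b bE] := subr_nat _ _ (natr_nat _ q) iiB1 ltac:(lra).
  exists (class_dim rho), a, b, p, q.
  split; rewrite ?class_dim_gt0 -?(ltr0n rat) //; try lra.
  move=> f f0; rewrite !weightD.
  rewrite (@weight_seg f rho Aj Bi (a + p) (b + p + q)) ?natrD //; [|lra..].
  rewrite (@weight_seg f rho Ai Bj (a + q) b) ?natrD //; [|lra..].
  rewrite (@weight_seg f rho Ai Bi a (b + q)) ?natrD //; [|lra..].
  rewrite (@weight_seg f rho Aj Bj (a + p + q) (b + p)) ?natrD //; [|lra..].
  by rewrite -!mulnA -!mulnDr.
- move=> [[/andP[iiD iiB] /andP[jjD _] /andP[jiD _] _] [ltA ltB leAB]].
  have [p pE] := subr_nat _ _ iiD jiD ltac:(lra).
  have [q qE] := subr_nat _ _ jjD jiD ltac:(lra).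
  have /natrP[b bE] : (Ai - Bi + 1)%R \is a Num.nat by rewrite rpredD ?rpred1.
  have jjD1 : (Aj + Bj + 1)%R \is a Num.nat by rewrite rpredD ?rpred1.
  (* Here [a] is [Ai + Bj + 1], zero exactly when the second target summand is omitted. *)
  have [a aE] := subr_nat _ _ (natr_nat _ p) jjD1 ltac:(lra).
  exists (class_dim rho), a, b, p, q.
  split; rewrite ?class_dim_gt0 -?(ltr0n rat) //; try lra.
  move=> f f0; rewrite !weightD.
  rewrite (@weight_seg f rho Ai Bi (a + q) b) ?natrD //; [|lra..].
  rewrite (@weight_seg f rho Aj Bj (a + p) (b + p + q)) ?natrD //; [|lra..].
  rewrite (@weight_seg f rho Aj Bi (a + p + q) (b + p)) ?natrD //; [|lra..].
  rewrite (@weight_seg f rho Ai Bj a (b + q)) ?natrD //; [|lra..].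
  by rewrite -!mulnA -!mulnDr; split; rewrite // addnC.
- move=> [/andP[/natrP[p pE] _] _].
  (* The third move is the degenerate case [a = b = 0]: the partner summand is empty on both
     sides. *)
  exists (class_dim rho), 0, 0, (p + 1), 1.
  split; rewrite ?class_dim_gt0 ?addn_gt0 ?orbT // => f f0.
  rewrite (@weight_seg f rho Ak (- (1 / 2))%R (p + 1) (p + 2)) ?natrD //; [|lra..].
  rewrite (@weight_seg f rho Ak (1 / 2)%R (p + 2) (p + 1)) ?natrD //; [|lra..].
  by rewrite f0 !mul0n !muln0 !add0n !addn0 -addnA !mulnA.
Qed.

Lemma weight_apply_op f T psi : op_source T `<=` psi ->
  weight f (apply_op T psi) + weight f (op_source T) =
    weight f psi + weight f (op_target T).
Proof.
move=> sub; have {2}-> : psi = (psi `\` op_source T) `+` op_source T.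
  by apply/msetP => s; rewrite !msetE2 subnK //; apply/msubsetP.
by rewrite /apply_op !weightD addnAC.
Qed.

Lemma applicable_geD T psi : applicable T psi ->
  geD (apply_op T psi) psi /\
  weight (expn^~ 2) psi < weight (expn^~ 2) (apply_op T psi).
Proof.
move=> [/op_weight[d [a [b [p [q [d_gt0 p_gt0 q_gt0 wE]]]]]] sub _ _].
split; last first.
  have [e1 e2] := wE (expn^~ 2) erefl.
  rewrite -(ltn_add2r (weight (expn^~ 2) (op_source T))) weight_apply_op //.
  rewrite ltn_add2l e1 e2 ltn_pmul2l //.
  (* The sum of squares grows by [d * (2 * b * p * q + p * q * (p + q))]. *)
  have : 0 < p * q * (p + q) by rewrite !muln_gt0 p_gt0 q_gt0 addn_gt0 p_gt0.
  nia.
apply: dominates_convex => [||t].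
- by apply: sort_sorted => x y; rewrite /geq /=; exact: leq_total.
- have [e1 e2] := wE id erefl; rewrite !sumn_pD.
  apply/(@addIn (weight id (op_source T))); rewrite weight_apply_op //.
  by congr addn; rewrite e1 e2; congr muln; nia.
rewrite !weight_pD; have [e1 e2] := wE (subn^~ t) erefl.
rewrite -(leq_add2r (weight (subn^~ t) (op_source T))) weight_apply_op //.
rewrite leq_add2l e1 e2 leq_mul2l; apply/orP; right.
(* The change splits into [b] times [cvx], the spreading of one pair, plus [jensen]: [a + p] is the
   mean of [a] and [a + p + q] with weights [q] and [p]. *)
have cvx : a + p - t + (a + q - t) <= a - t + (a + p + q - t) by lia.
have jensen : (p + q) * (a + p - t) <= q * (a - t) + p * (a + p + q - t).
  have [le_ta|lt_at] := leqP t a; first by nia.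
  have [le_tap|lt_apt] := leqP t (a + p); last by nia.
  nia.
nia.
Qed.

(** * Extremal elements for the raising order *)

Lemma geO_trans psi1 psi2 psi3 : geO psi1 psi2 -> geO psi2 psi3 -> geO psi1 psi3.
Proof. by elim=> // phi1 phi2 T _ IH Tphi1 /IH ge23; apply: geO_raise. Qed.

Lemma geO_geD psi phi : geO psi phi -> geD psi phi.
Proof.
elim=> [psi'|psi1 psi2 T _ ge12 /applicable_geD[geT _]]; first exact: dominates_refl.
exact: dominates_trans geT ge12.
Qed.

Lemma geO_weight psi phi : geO psi phi ->
  psi = phi \/ weight (expn^~ 2) phi < weight (expn^~ 2) psi.
Proof.
elim=> [psi'|psi1 psi2 T _ IH /applicable_geD[_ ltT]]; first by left.
by right; case: IH => [<- //|lt12]; apply: ltn_trans ltT.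
Qed.

Lemma weight_sqr_bound psi phi : geD psi phi ->
  weight (expn^~ 2) psi <= sumn (pD phi) ^ 2.
Proof. by move=> [<- _]; rewrite -weight_pD leq_sumn_sqr. Qed.

Lemma geO_max (S : param -> Prop) psi_max psi :
  unique (maximal_O S) psi_max -> S psi -> geO psi_max psi.
Proof.
move=> [_ uniq_max].
(* The measure is the room left below a bound that stays constant along [geO], since dominance
   preserves the total. *)
have [n] := ubnP (sumn (pD psi) ^ 2 - weight (expn^~ 2) psi).
elim: n psi => // n IHn psi lt_n Spsi.
have [[phi [Sphi ge_phi ne_phi]]|no_phi] :=
    EM (exists phi, [/\ S phi, geO phi psi & phi <> psi]); last first.
  have -> : psi_max = psi; last exact: geO_refl.
  apply: uniq_max; split=> // phi Sphi ge_phi.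
  by apply: contrapT => ne_phi; apply: no_phi; exists phi.
apply: (geO_trans _ ge_phi); apply: IHn => //.
have [//|lt_phi] := geO_weight ge_phi.
have geD_phi := geO_geD ge_phi; have := weight_sqr_bound geD_phi.
by rewrite geD_phi.1; lia.
Qed.

Lemma geO_min (S : param -> Prop) psi_min psi :
  unique (minimal_O S) psi_min -> S psi -> geO psi psi_min.
Proof.
move=> [_ uniq_min].
have [n] := ubnP (weight (expn^~ 2) psi).
elim: n psi => // n IHn psi lt_n Spsi.
have [[phi [Sphi ge_phi ne_phi]]|no_phi] :=
    EM (exists phi, [/\ S phi, geO psi phi & phi <> psi]); last first.
  have -> : psi_min = psi; last exact: geO_refl.
  apply: uniq_min; split=> // phi Sphi ge_phi.
  by apply: contrapT => ne_phi; apply: no_phi; exists phi.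
apply: (geO_trans ge_phi); apply: IHn => //.
have [/esym //|lt_phi] := geO_weight ge_phi.
exact: leq_trans lt_phi _.
Qed.

Lemma Psi_pD_gt0 (G : classicalGroup F) psi : Psi G psi -> all (ltn 0) (pD psi).
Proof.
move=> [pos _ _ _]; apply/allP => x; rewrite mem_sort.
case/flatten_mapP => -[[rho a] b] /pos /andP[a_gt0 _].
by rewrite mem_nseq => /andP[_ /eqP->].
Qed.

(** Mutual dominance only equates the partitions, hence the sums of squares; comparability under
    [geO] then rules out distinct parameters. *)
Lemma geO_geD_eq (G : classicalGroup F) psi phi : Psi G psi -> Psi G phi ->
  geO psi phi -> geD phi psi -> psi = phi.
Proof.
move=> Gpsi Gphi geO_psi geD_phi.
have [//|] := geO_weight geO_psi.
rewrite -!weight_pD (dominates_anti _ _ (geO_geD geO_psi) geD_phi) ?ltnn //.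
- exact: Psi_pD_gt0 Gpsi.
- exact: Psi_pD_gt0 Gphi.
Qed.

End Params.

Theorem theorem7p7 (R : realType) (F : localField) (Fbar : closedFieldType)
    (iota : {rmorphism F -> Fbar}) (hFbar : algebraic_closure iota)
    (G : classicalGroup F)
    (packet : param R iota -> groupIrr R G -> Prop) :
  [/\ (forall (psi : param R iota) (T : raising_op R iota),
         Psi G psi -> applicable T psi -> gtD (apply_op T psi) psi),
      (forall psi psi' : param R iota,
         Psi G psi -> Psi G psi' -> geO psi psi' -> geD psi psi') &
      (forall pi : groupIrr R G, arthur_type packet pi ->
       forall psi_max psi_min : param R iota,
         is_psi_max packet pi psi_max -> is_psi_min packet pi psi_min ->
         [/\ Psi_of packet pi psi_max,
             Psi_of packet pi psi_min,
             (forall psi, Psi_of packet pi psi ->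
                geD psi_max psi /\ geD psi psi_min) &
             (forall phi_max phi_min : param R iota,
                Psi_of packet pi phi_max -> Psi_of packet pi phi_min ->
                (forall psi, Psi_of packet pi psi ->
                   geD phi_max psi /\ geD psi phi_min) ->
                phi_max = psi_max /\ phi_min = psi_min)])].
Proof.
split=> [psi T _ /applicable_geD[geT ltT]|psi psi' _ _|].
(* Equal partitions would have equal sums of squares. *)
- by split=> // eqT; move: ltT; rewrite -!weight_pD eqT ltnn.
- exact: geO_geD.
move=> pi _ psi_max psi_min maxP minP.
have Smax := maxP.1.1; have Smin := minP.1.1.
split=> // [psi Spsi|phi_max phi_min Sphi_max Sphi_min geD_phi].
  by split; apply: geO_geD; [apply: geO_max maxP Spsi|apply: geO_min minP Spsi].
split.
- apply/esym; apply: (geO_geD_eq Smax.1 Sphi_max.1 (geO_max maxP Sphi_max)).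
  exact: (geD_phi _ Smax).1.
- apply: (geO_geD_eq Sphi_min.1 Smin.1 (geO_min minP Sphi_min)).
  exact: (geD_phi _ Smin).2.
Qed.
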